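(* Let $k\geq 1$ be an integer. Suppose that the edges of the complete graph $K_n$ are coloured with two colours, red and blue. Then the following hold. \begin{itemize} \item The vertices of $K_n$ can be covered with $k$ disjoint red paths and a blue $k$th power of a path that is disjoint from all of these red paths. \item If the red spanning subgraph of $K_n$ is connected, then the vertices of $K_n$ can be covered with $k$ disjoint red paths and a blue $(k+1)$th power of a path that is disjoint from all of these red paths. \end{itemize}
   Context: The red spanning subgraph is the graph with vertex set $V(K_n)$ whose edges are the red edges. All subgraphs in a cover are pairwise vertex-disjoint, and together their vertex sets are all of $V(K_n)$. Paths and powers of paths are allowed to be empty (no vertices) or to consist of a single vertex. The $t$th power of a path of order $s$, denoted $P_s^t$, is the graph with vertex set $\{1,\dots,s\}$ in which $ij$ is an edge whenever $1\leq |i-j|\leq t$. A blue $t$th power of a path in a coloured $K_n$ is a (not necessarily induced) subgraph isomorphic to some $P_s^t$ all of whose edges are blue; similarly a red path is a path subgraph all of whose edges are red. *)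

(* Defs.v *)
From mathcomp Require Import all_boot all_order all_algebra.

Set Implicit Arguments.
Unset Strict Implicit.
Unset Printing Implicit Defensive.

Import GRing.Theory Num.Theory.

Variant colour := Red | Blue.

Definition is_red (a : colour) : bool := if a is Red then true else false.

Section Graphs.

Variables (T : finType) (e : rel T).

Definition connected_graph : Prop := forall x y : T, connect e x y.

(* [p] lists the vertices of a path in order; it may be empty or a singleton. *)
Definition is_path (p : seq T) : bool := uniq p && sorted e p.

(* The adjacency relation of P_s^t, with vertices 0, ..., s - 1. *)
Definition path_power (s t : nat) : rel 'I_s :=
  fun i j => (1 <= `|(i%:Z - j%:Z)%R|%N <= t)%N.

(* The position i in [q] is the i-th vertex of P_s^t, where s = size q; the
   copy is not required to be induced. *)
Definition is_path_power (t : nat) (q : seq T) : Prop :=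
  uniq q /\
  forall i j : 'I_(size q), path_power t i j ->
    e (tnth (in_tuple q) i) (tnth (in_tuple q) j).

End Graphs.

Section Colouring.

(* A symmetric [c] encodes a colouring of the edges of K_n; its values on the
   diagonal are ignored. *)
Variables (n : nat) (c : 'I_n -> 'I_n -> colour).

Definition red : rel 'I_n := fun x y => (x != y) && is_red (c x y).

Definition blue : rel 'I_n := fun x y => (x != y) && ~~ is_red (c x y).

Definition covered_by (k t : nat) : Prop :=
  exists (p : 'I_k -> seq 'I_n) (q : seq 'I_n),
    [/\ forall i, is_path red (p i),
        is_path_power blue t q,
        forall i j, i != j -> [disjoint p i & p j],
        forall i, [disjoint p i & q]
      & forall v, v \in q \/ exists i, v \in p i].

End Colouring.

(* Main.v *)
Require Import Defs.
From mathcomp Require Import all_boot.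
From mathcomp Require Import zify.
From Stdlib Require Import Classical_Prop.

Set Implicit Arguments.
Unset Strict Implicit.
Unset Printing Implicit Defensive.

(** Let S be the set of vertices covered by k disjoint red paths, and call the
    connected components of the red graph outside S the classes.  Vertices of
    different classes are joined by blue edges, so a blue t-th power of a path
    covering the complement of S is obtained by listing that complement in such
    a way that two vertices of the same class are always more than t places
    apart.  This is the problem of scheduling jobs with a cooling time.  If the
    largest classes have m + 1 vertices, and the vertices lying in no largest
    class number at least t * m, then such a list exists
    ([spread_classes]): deal the vertices of the largest classes into m + 1
    consecutive frames and the others into the first m of them.

    So it is enough to choose the paths well.  Let m + 1 be the least possible
    value of the maximal class size (if all vertices can be covered, there is
    nothing to prove), then minimise the number of vertices in classes of that
    size (the large vertices), then the number of covered vertices.  For such a choice: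
    - one cannot cover further vertices with a large one among them, since
      classes only shrink when more is covered; hence no path is empty and no
      endpoint of a path has a large neighbour;
    - the classes adjacent to an endpoint v have together at least m vertices,
      since otherwise v could be dropped from its path: it would merge only
      with these classes, into a class of at most m vertices
      ([comps_at_end]);
    - endpoints of two different paths have no adjacent class in common:
      otherwise the two paths could be joined through it, and the path that
      becomes free could start at a large vertex
      ([disjoint_comps_at_ends]).
    One endpoint from each path therefore gives k * m vertices outside the
    large classes, and t = k works.

    If the red graph is connected, some path has a vertex z adjacent to a large
    vertex.  The two endpoints of that path have no adjacent class in common
    either: otherwise the path closes up to a cycle through that class, and the
    cycle can be opened at z and continued to the large vertex
    ([disjoint_comps_at_same_path]).  This gives one more set of m vertices, and
    t = k + 1 works. *)

(** * Listing a set with members of the same class far apart *)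

Section Spreading.
Variable T : finType.
Implicit Types (N P X L : {set T}) (key kappa : T -> nat).

Let key_total key : total (fun x y : T => key x <= key y).
Proof. by move=> x y; apply: leq_total. Qed.

Let key_trans key : transitive (fun x y : T => key x <= key y).
Proof. by move=> y x z; apply: leq_trans. Qed.

Lemma sort_by_key N key :
  exists s : seq T, [/\ uniq s, s =i N &
    forall x0 i j, i <= j -> j < size s -> key (nth x0 s i) <= key (nth x0 s j)].
Proof.
exists (sort (fun x y => key x <= key y) (enum N)); split.
- by rewrite sort_uniq enum_uniq.
- by move=> x; rewrite mem_sort mem_enum.
move=> x0 i j le_ij lt_j.
apply: (sorted_leq_nth (@key_trans key) _ x0 (sort_sorted (@key_total key) _)) => //.
by rewrite inE (leq_ltn_trans le_ij).
Qed.

(** Listing the classes one after the other puts two members of a class less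
    than a class size apart. *)
Lemma grouped_enum P kappa w :
  {in P, forall x, #|[set y in P | kappa y == kappa x]| <= w} ->
  exists s : seq T, [/\ uniq s, s =i P & forall x0 i j, i < j -> j < size s ->
    kappa (nth x0 s i) = kappa (nth x0 s j) -> j < i + w].
Proof.
move=> small; have [s [Us sP mono]] := sort_by_key P kappa.
exists s; split=> // x0 i j lt_ij lt_j eq_k.
have lt_i := ltn_trans lt_ij lt_j.
have /small le_w : nth x0 s i \in P by rewrite -sP mem_nth.
suff : j - i < w by lia.
apply: leq_trans le_w.
have Ub : uniq (take (j - i).+1 (drop i s)) by rewrite take_uniq ?drop_uniq.
have <- : size (take (j - i).+1 (drop i s)) = (j - i).+1.
  by rewrite size_takel // size_drop; lia.
rewrite -(card_uniqP Ub); apply/subset_leq_card/subsetP=> y y_in.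
rewrite inE -sP (mem_drop (mem_take y_in)) /=.
case/(nthP x0): y_in => l; rewrite size_takel; last by rewrite size_drop ltn_sub2r.
move=> lt_l <-; rewrite nth_take // nth_drop eqn_leq.
by rewrite {1}eq_k !mono //; lia.
Qed.

(** In a list sorted by an injective key, the elements whose key is at least that
    of u and less than that of w are exactly those listed from u to just before
    w; so the distance of u and w in the list can be bounded by counting keys. *)
Lemma spread_of_keys N key (R : rel T) t :
  {in N &, injective key} ->
  {in N &, forall u w, R u w -> key u < key w ->
     t < #|[set y in N | key u <= key y < key w]|} ->
  exists s : seq T, [/\ uniq s, s =i N & forall x0 i j,
    i < j -> j < size s -> j <= i + t -> ~~ R (nth x0 s i) (nth x0 s j)].
Proof.
move=> inj_key far; have [s [Us sN mono]] := sort_by_key N key.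
exists s; split=> // x0 i j lt_ij lt_j le_j; apply/negP=> Rij.
have lt_i := ltn_trans lt_ij lt_j.
have iN : nth x0 s i \in N by rewrite -sN mem_nth.
have jN : nth x0 s j \in N by rewrite -sN mem_nth.
have lt_key : key (nth x0 s i) < key (nth x0 s j).
  rewrite ltn_neqAle mono ?(ltnW lt_ij) // andbT; apply/eqP=> /(inj_key _ _ iN jN).
  by move/eqP; rewrite nth_uniq //; lia.
have := far _ _ iN jN Rij lt_key; apply/negP; rewrite -leqNgt.
apply: leq_trans (_ : size (take (j - i) (drop i s)) <= _); last first.
  by rewrite size_take_min size_drop; lia.
apply: leq_trans (card_size _); apply/subset_leq_card/subsetP=> y.
rewrite inE -sN => /and3P[y_s le_i lt_jy].
have lt_y : index y s < size s by rewrite index_mem.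
have le_iy : i <= index y s.
  rewrite leqNgt; apply/negP=> lt_yi; have := mono x0 _ _ (ltnW lt_yi) lt_i.
  rewrite nth_index // => le_yi; have eq_k : key y = key (nth x0 s i) by lia.
  have eq_y := inj_key _ _ _ iN eq_k; rewrite eq_y ?index_uniq -?sN // in lt_yi.
  by rewrite ltnn in lt_yi.
have lt_yj : index y s < j.
  rewrite ltnNge; apply/negP=> le_jy; have := mono x0 _ _ le_jy lt_y.
  by rewrite nth_index //; lia.
apply/(nthP x0); exists (index y s - i).
  by rewrite size_takel ?ltn_sub2r // size_drop leq_sub2r // ltnW.
by rewrite nth_take ?nth_drop ?subnKC ?nth_index //; lia.
Qed.

(** Deal a list of P, class after class, cyclically into w frames.  Members of
    one class get different frames because the class has at most w elements.
    The frames are filled from the last one to the first: when a class runs past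
    frame 0 into the next round, its members of that round sit in later frames,
    so along increasing frames its rounds never decrease.  A complete round
    reaches every frame, and the rounds of a frame are filled in order, which is
    why the cells (frame, round) of the last conclusion are occupied. *)
Lemma deal_classes P kappa w :
  {in P, forall x, #|[set y in P | kappa y == kappa x]| <= w} ->
  exists frame round : T -> nat, [/\
    {in P, forall x, frame x < w /\ round x < #|P|},
    {in P &, forall x y, frame x = frame y -> round x = round y -> x = y},
    {in P &, forall x y, kappa x = kappa y -> x != y ->
       frame x != frame y /\ (frame x < frame y -> round x <= round y)} &
    forall f r, f < w ->
      r.+1 * w <= #|P| \/ (exists2 y, y \in P & frame y = f /\ r <= round y) ->
      exists2 x, x \in P & frame x = f /\ round x = r].
Proof.
move=> small; have [s [Us sP near]] := grouped_enum small.
have szP : size s = #|P| by rewrite -(card_uniqP Us); apply: eq_card.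
have idx x : x \in P -> index x s < #|P| by rewrite -szP index_mem sP.
have w_gt0 x : x \in P -> 0 < w.
  move=> xP; apply: leq_trans (small x xP); apply/card_gt0P; exists x.
  by rewrite inE xP eqxx.
exists (fun x => w.-1 - index x s %% w), (fun x => index x s %/ w); split.
- move=> x xP; split; first by have := w_gt0 x xP; lia.
  exact: leq_ltn_trans (leq_div _ _) (idx x xP).
- move=> x y xP yP Ef Er; have w0 := w_gt0 x xP.
  have := ltn_pmod (index x s) w0; have := ltn_pmod (index y s) w0 => lty ltx.
  rewrite -(nth_index x (_ : x \in s)) ?sP // -[RHS](nth_index x (_ : y \in s)) ?sP //.
  by congr nth; rewrite (divn_eq (index x s) w) (divn_eq (index y s) w) Er; lia.
- move=> x y xP yP Ek ne_xy; have w0 := w_gt0 x xP.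
  have nth_s z : z \in P -> nth x s (index z s) = z by move=> ?; rewrite nth_index ?sP.
  have close u v : u \in P -> v \in P -> kappa u = kappa v ->
    index u s < index v s -> index v s < index u s + w.
    by move=> uP vP E lt; apply: (near x) => //; rewrite ?szP ?idx ?nth_s.
  have := close x y xP yP Ek; have := close y x yP xP (esym Ek).
  have : index x s != index y s.
    by apply: contra ne_xy => /eqP E; rewrite -(nth_s x) // E nth_s.
  have := divn_eq (index x s) w; have := divn_eq (index y s) w.
  have := ltn_pmod (index x s) w0; have := ltn_pmod (index y s) w0.
  move: (index x s) (index y s) => a b.
  move: (a %% w) (b %% w) (a %/ w) (b %/ w) => a1 b1 a2 b2 lt1 lt2 E1 E2 ne c1 c2.
  have up : a2 < b2 -> a2 * w + w <= b2 * w.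
    by move=> lt; rewrite addnC -mulSn leq_mul2r lt orbT.
  have down : b2 < a2 -> b2 * w + w <= a2 * w.
    by move=> lt; rewrite addnC -mulSn leq_mul2r lt orbT.
  split; [apply/eqP=> E|move=> lt].
    by case: (ltngtP a2 b2) => [/up|/down|E2']; rewrite ?E2' in E1 *; lia.
  by rewrite leqNgt; apply/negP=> /down; lia.
move=> f r lt_f H; pose l := r * w + (w.-1 - f).
have lt_l : l < #|P|.
  rewrite /l; case: H => [le|[y yP [Ef le_r]]]; first by rewrite mulSn in le; lia.
  apply: leq_ltn_trans (idx y yP); rewrite (divn_eq (index y s) w).
  have := ltn_pmod (index y s) (w_gt0 y yP).
  have := leq_mul le_r (leqnn w); lia.
have [x0 _] : exists x0, x0 \in P by apply/card_gt0P; lia.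
exists (nth x0 s l); first by rewrite -sP mem_nth ?szP.
rewrite index_uniq ?szP // modnMDl modn_small; last lia.
by rewrite divnMDl ?divn_small; lia.
Qed.

Lemma card_of_values (A : {set T}) key (K : nat -> nat) t :
  {in gtn t &, injective K} ->
  (forall r, r < t -> exists2 y, y \in A & key y = K r) -> t <= #|A|.
Proof.
move=> injK val; rewrite -(size_iota 0 t) -(size_map K) cardE -(size_map key).
apply: uniq_leq_size.
  rewrite map_inj_in_uniq ?iota_uniq // => x y.
  by rewrite !mem_iota => ? ?; apply: injK; rewrite inE.
move=> z /mapP[r]; rewrite mem_iota => /= lt ->.
by have [y yA <-] := val r lt; rewrite map_f // mem_enum.
Qed.

(** The list runs through m + 1 frames.  X is dealt into all of them and L into
    the first m, and inside a frame the elements of X precede those of L.  Each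
    of the first m frames then holds at least t elements of L, and every frame
    holds an element of X.  Two members of a class lie in different frames and,
    by [deal_classes], the later one is at least as deep in its frame, so their
    distance is at least the length of the earlier frame, which exceeds t. *)
Lemma spread_classes X L kappa m t :
  [disjoint X & L] ->
  {in X, forall x, #|[set y in X | kappa y == kappa x]| <= m.+1} ->
  {in L, forall x, #|[set y in L | kappa y == kappa x]| <= m} ->
  {in X & L, forall x y, kappa x != kappa y} ->
  m < #|X| -> t * m <= #|L| ->
  exists s : seq T, [/\ uniq s, s =i X :|: L & forall x0 i j,
    i < j -> j < size s -> j <= i + t -> kappa (nth x0 s i) != kappa (nth x0 s j)].
Proof.
move=> disXL smallX smallL sep ltX leL.
have [fX [rX [bX injX nearX cellX]]] := deal_classes smallX.
have [fL [rL [bL injL nearL cellL]]] := deal_classes smallL.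
(* All rounds are less than n, so shifting the rounds of L by n puts X first in
   each frame, and all offsets in a frame are less than B. *)
pose n := #|T|.+1; pose B := n + n.
have leXn : #|X| < n by rewrite ltnS max_card.
have leLn : #|L| < n by rewrite ltnS max_card.
pose frame x := if x \in X then fX x else fL x.
pose off x := if x \in X then rX x else n + rL x.
pose key x := frame x * B + off x.
have notX x : x \in L -> (x \in X) = false by move=> xL; rewrite (disjointFl disXL).
have offB x : x \in X :|: L -> off x < B.
  rewrite !inE /off; case: ifP => [xX _|_ /= xL]; first by have [] := bX x xX; lia.
  by have [] := bL x xL; lia.
have key_lt x y : x \in X :|: L -> frame x < frame y -> key x < key y.
  by move=> /offB; rewrite /key; nia.
have key_inj x y : x \in X :|: L -> y \in X :|: L -> key x = key y ->
    frame x = frame y /\ off x = off y.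
  move=> xN yN E; case: (ltngtP (frame x) (frame y)) => [lt|lt|eqf].
  - by have := key_lt _ _ xN lt; lia.
  - by have := key_lt _ _ yN lt; lia.
  - by split=> //; move: E; rewrite /key eqf; lia.
have inj_key : {in X :|: L &, injective key}.
  move=> x y xN yN /(key_inj x y xN yN)[].
  move: xN yN; rewrite !inE /frame /off; case: ifP => [xX _|_ /= xL];
    case: ifP => [yX _|_ /= yL].
  - exact: injX.
  - by have [] := bX x xX; lia.
  - by have [] := bX y yX; lia.
  - by move=> E /addnI; apply: injL.
have memXL x : x \in X -> x \in X :|: L by rewrite inE => ->.
have memLX x : x \in L -> x \in X :|: L by rewrite inE orbC => ->.
have fullL f r : f < m -> r < t -> exists2 x, x \in L & key x = f * B + (n + r).
  move=> lt_f lt_r; have [|x xL [Ef Er]] := cellL f r lt_f.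
    by left; apply: leq_trans leL; rewrite leq_mul2r lt_r orbT.
  by exists x => //; rewrite /key /frame /off notX // Ef Er.
have far : {in X :|: L &, forall u w, kappa u == kappa w -> key u < key w ->
     t < #|[set y in X :|: L | key u <= key y < key w]|}.
  move=> u w uN wN /eqP Ek lt_key.
  have ne_uw : u != w by apply: contraTneq lt_key => ->; rewrite ltnn.
  have le_f : frame u <= frame w.
    by rewrite leqNgt; apply/negP=> /(key_lt _ _ wN); lia.
  have := offB u uN; have := offB w wN.
  move: (uN) (wN); rewrite !inE.
  have [uX _|_ /= uL] := boolP (u \in X);
    have [wX _|_ /= wL] := boolP (w \in X).
  - have [ne_f le_r] := nearX _ _ uX wX Ek ne_uw.
    have Efu : frame u = fX u by rewrite /frame uX.
    have Efw : frame w = fX w by rewrite /frame wX.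
    have Eou : off u = rX u by rewrite /off uX.
    have [ltfw _] := bX w wX; have [_ ltru] := bX u uX.
    move=> ltw ltu.
    (* The witnesses are u and the first t elements of L in the frame of u. *)
    apply: (@card_of_values _ key
      (fun r => if r == t then key u else frame u * B + (n + r))).
      move=> x y; rewrite !inE => ltx lty.
      by case: eqP; case: eqP; rewrite /key ?Eou; lia.
    move=> r lt_r; case: eqP => [_|ne_r].
      by exists u; rewrite // inE uN leqnn.
    have [||y yL Ey] := fullL (frame u) r; try lia.
    exists y => //; rewrite inE memLX //= Ey.
    by rewrite /key in lt_key *; nia.
  - by have := sep u w uX wL; rewrite Ek eqxx.
  - by have := sep w u wX uL; rewrite Ek eqxx.
  have [ne_f le_r] := nearL _ _ uL wL Ek ne_uw.
  have Efu : frame u = fL u by rewrite /frame notX.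
  have Efw : frame w = fL w by rewrite /frame notX.
  have Eou : off u = n + rL u by rewrite /off notX.
  have Eow : off w = n + rL w by rewrite /off notX.
  have [ltfw ltrw] := bL w wL; have [ltfu ltru] := bL u uL.
  have lt_f : fL u < fL w by lia.
  have {}le_r := le_r lt_f.
  have lt_tn : t < n.
    by apply: leq_ltn_trans leLn; apply: leq_trans leL; rewrite leq_pmulr //; lia.
  have step : frame u * B + B <= frame w * B.
    by rewrite addnC -mulSn leq_mul2r Efu Efw lt_f orbT.
  move=> ltw ltu.
  (* The witnesses are the first element of X in the frame of w and, for every
     r < t, the element of L in round r: in the frame of w when r is less than
     the round of u, in the frame of u otherwise. *)
  apply: (@card_of_values _ key (fun r => if r == t then frame w * B else
     if r < rL u then frame w * B + (n + r) else frame u * B + (n + r))).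
    move=> x y; rewrite !inE => ltx lty.
    case: eqP => [->|nex]; case: eqP => [->|ney] //.
    - by case: ltnP; lia.
    - by case: ltnP; lia.
    - by case: ltnP => ?; case: ltnP => ? E; lia.
  move=> r lt_r; case: eqP => [_|ne_r].
    have [||y yX [Ef Er]] := cellX (fL w) 0; first by lia.
      by left; rewrite mul1n.
    have Ey : key y = frame w * B by rewrite Efw /key /frame /off yX Ef Er addn0.
    exists y => //; rewrite inE memXL //= Ey.
    by rewrite /key Eow; lia.
  case: ltnP => [lt_ru|le_ur].
    have [|y yL [Ef Er]] := cellL (fL w) r ltfw.
      by right; exists w => //; split=> //; lia.
    have Ey : key y = frame w * B + (n + r) by rewrite Efw /key /frame /off notX // Ef Er.
    exists y => //; rewrite inE memLX //= Ey.
    by rewrite /key Eow Eou; lia.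
  have [||y yL Ey] := fullL (frame u) r; try lia.
  exists y => //; rewrite inE memLX //= Ey.
  by rewrite /key Eow Eou; lia.
have [s [Us sN H]] := spread_of_keys inj_key far.
by exists s; split.
Qed.
End Spreading.

(** * Components outside a vertex set *)

Section Components.
Variables (T : finType) (e : rel T).
Hypothesis e_sym : symmetric e.
Implicit Types (S : {set T}) (x y v w : T) (m : nat).

Definition off S : rel T := [rel x y | [&& e x y, x \notin S & y \notin S]].
Definition comp S x : {set T} := [set y | connect (off S) x y].

(** The union of the components outside S that contain a neighbour of v. *)
Definition comps_at S v : {set T} :=
  [set w in ~: S | [exists u, e v u && connect (off S) u w]].

Definition comps_le m S := forall x, x \notin S -> #|comp S x| <= m.
Definition large m S : {set T} := [set x in ~: S | m < #|comp S x|].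

Lemma offE S x y : off S x y = [&& e x y, x \notin S & y \notin S].
Proof. by []. Qed.

Lemma off_csym S : connect_sym (off S).
Proof. by apply: sym_connect_sym => x y; rewrite !offE e_sym [(x \notin _) && _]andbC. Qed.

Lemma connect_closed (r : rel T) (A : {set T}) x :
  (forall y z, y \in A -> r y z -> z \in A) -> x \in A ->
  [set y | connect r x y] \subset A.
Proof.
move=> clA xA; apply/subsetP=> y; rewrite inE => /connectP[p].
elim: p x xA => [|z p IHp] x xA /=; first by move=> _ ->.
by case/andP=> /(clA _ _ xA) zA; apply: IHp.
Qed.

Lemma comp_notin S x y : y \in comp S x -> (y \in S) = (x \in S).
Proof.
rewrite inE => /connectP[p]; elim: p x => [|z p IHp] x /= ; first by move=> _ ->.
by case/andP=> /and3P[_ /negPf-> /negPf zS] /IHp IH /IH; rewrite zS.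
Qed.

Lemma comp_eq S x y : y \in comp S x -> comp S y = comp S x.
Proof.
by rewrite inE => xy; apply/setP=> z; rewrite !inE (same_connect (@off_csym S) xy).
Qed.

Lemma comp_mono S S' x : S \subset S' -> comp S' x \subset comp S x.
Proof.
move=> /subsetP sub; apply/subsetP=> y; rewrite !inE; apply: connect_sub => {x y} x y.
case/and3P=> exy xS' yS'; apply: connect1; rewrite offE exy.
by rewrite (contra (sub _) xS') (contra (sub _) yS').
Qed.

Lemma comps_le_mono m S S' : S \subset S' -> comps_le m S -> comps_le m S'.
Proof.
move=> sub le x xS'.
apply: leq_trans (le x _); last by apply: contra xS'; apply: (subsetP sub).
exact/subset_leq_card/comp_mono.
Qed.

Lemma large_mono m S S' : S \subset S' -> large m S' \subset large m S.
Proof.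
move=> sub; apply/subsetP=> x; rewrite !inE => /andP[xS' lt].
rewrite (contra (subsetP sub x) xS') /=; apply: leq_trans lt _.
exact/subset_leq_card/comp_mono.
Qed.

Lemma large_comp m S x y : x \in large m S -> y \in comp S x -> y \in large m S.
Proof.
move=> xL yx; rewrite inE (comp_eq yx) in_setC (comp_notin yx).
by move: xL; rewrite !inE.
Qed.

Lemma comps_at_comp S v w y : w \in comps_at S v -> y \in comp S w -> y \in comps_at S v.
Proof.
rewrite inE in_setC => /andP[wS /existsP[u /andP[vu uw]]] yw.
rewrite inE in_setC (comp_notin yw) wS; apply/existsP; exists u; rewrite vu.
by apply: connect_trans uw _; rewrite inE in yw.
Qed.

(** Uncovering v glues v to the components adjacent to it and leaves the other
    components as they are; inclusions suffice here. *)
Lemma comp_drop S v x : v \in S -> x \notin S :\ v ->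
  comp (S :\ v) x \subset v |: comps_at S v \/
  [/\ x \notin S, x \notin v |: comps_at S v & comp (S :\ v) x \subset comp S x].
Proof.
move=> vS xSv.
have [xN|xN] := boolP (x \in v |: comps_at S v); [left|right].
  apply: connect_closed xN => y z; rewrite !in_setU1 => yN /and3P[yz ySv zSv].
  have [//|ne_z /=] := eqVneq z v.
  have zS : z \notin S by move: zSv; rewrite !inE ne_z.
  case/orP: yN => [/eqP yv|yN].
    rewrite inE in_setC zS; apply/existsP; exists z.
    by rewrite -yv yz connect0.
  apply: (comps_at_comp yN); rewrite inE; apply: connect1.
  by rewrite offE yz zS andbT; move: yN; rewrite inE in_setC => /andP[].
have xS : x \notin S.
  by move: xSv xN; rewrite !inE; case: eqP.
split=> //; apply: connect_closed; last by rewrite inE connect0.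
move=> y z yx /and3P[yz ySv zSv].
have yS : y \notin S by rewrite (comp_notin yx).
have zS : z \notin S.
  move: zSv; rewrite !inE; have [z_v|//] := eqVneq z v; move=> _.
  case/negP: xN; rewrite in_setU1; apply/orP; right; rewrite inE in_setC xS.
  apply/existsP; exists y; rewrite -z_v e_sym yz /= off_csym.
  by rewrite inE in yx.
move: yx; rewrite !inE => yx; apply: connect_trans yx _; apply: connect1.
by rewrite offE yz yS zS.
Qed.

Lemma drop_small m S v : v \in S -> #|comps_at S v| < m -> comps_le m S ->
  comps_le m (S :\ v).
Proof.
move=> vS lt le x /(comp_drop vS)[/subset_leq_card sub|[xS _ /subset_leq_card sub]].
  apply: leq_trans sub _; rewrite cardsU1; case: (_ \notin _); lia.
exact: leq_trans sub (le x xS).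
Qed.

Lemma large_drop m S v : v \in S -> #|comps_at S v| < m ->
  large m (S :\ v) \subset large m S.
Proof.
move=> vS lt; apply/subsetP=> x; rewrite inE in_setC => /andP[xSv lt_x].
case: (comp_drop vS xSv) => [/subset_leq_card sub|[xS _ /subset_leq_card sub]].
  have := leq_trans lt_x sub; rewrite cardsU1; case: (_ \notin _); lia.
by rewrite inE in_setC xS; apply: leq_trans lt_x sub.
Qed.

Lemma path_in_comp S u w : u \notin S -> connect (off S) u w ->
  exists p, [/\ uniq (u :: p), path e u p, last u p = w & {subset u :: p <= comp S u}].
Proof.
move=> uS /connectP[q path_q ->]; case/shortenP: path_q => p path_p Up _.
exists p; split=> //.
  by apply: sub_path path_p => x y /and3P[].
by move=> y yp; rewrite inE; apply: path_connect yp.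
Qed.

End Components.

(** * Systems of disjoint paths *)

Section PathSystems.
Variables (T : finType) (e : rel T).
Hypothesis e_sym : symmetric e.
Variable I : finType.
Implicit Types (p : I -> seq T) (S : {set T}).

Definition path_system p :=
  (forall i, is_path e (p i)) /\ (forall i j, i != j -> [disjoint p i & p j]).

Definition covered p : {set T} := [set v | [exists i, v \in p i]].

Definition subst_path p i s j := if j == i then s else p j.

Lemma subst_path_system p i s : path_system p -> is_path e s ->
  (forall j, j != i -> [disjoint s & p j]) -> path_system (subst_path p i s).
Proof.
move=> [pp dp] ps ds; split=> [j|j l]; rewrite /subst_path; first by case: ifP.
move=> ne; case: (eqVneq j i) => [Ej|ne_j]; case: (eqVneq l i) => [El|ne_l].
- by rewrite Ej El eqxx in ne.
- exact: ds.
- by rewrite disjoint_sym ds.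
- exact: dp.
Qed.

Lemma mem_covered p i v : v \in p i -> v \in covered p.
Proof. by move=> vi; rewrite inE; apply/existsP; exists i. Qed.

Lemma coveredP p v : reflect (exists i, v \in p i) (v \in covered p).
Proof. by rewrite inE; apply: existsP. Qed.

Lemma notin_covered p v i : v \notin covered p -> v \notin p i.
Proof. by apply: contra; apply: mem_covered. Qed.

(** Path i can be listed so that it stops at v; using an arbitrary listing of the
    same vertices treats both endpoints of the path alike. *)
Definition is_end p i v := exists2 s, is_path e (rcons s v) & rcons s v =i p i.

Lemma sorted_rev_sym s : sorted e (rev s) = sorted e s.
Proof. by rewrite rev_sorted; apply: eq_sorted => y z; apply: e_sym. Qed.

Lemma is_path_rev s : is_path e (rev s) = is_path e s.
Proof. by rewrite /is_path rev_uniq sorted_rev_sym. Qed.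

Lemma last_is_end p i x s : path_system p -> p i = x :: s -> is_end p i (last x s).
Proof.
by case=> pp _ E; exists (belast x s); rewrite -lastI -E.
Qed.

Lemma head_is_end p i x s : path_system p -> p i = x :: s -> is_end p i x.
Proof.
case=> pp _ E; exists (rev s); rewrite -rev_cons -E; first by rewrite is_path_rev.
by move=> y; rewrite mem_rev.
Qed.

Lemma is_path_cat s v y t : is_path e (rcons s v) -> is_path e (y :: t) -> e v y ->
  {in y :: t, forall w, w \notin rcons s v} -> is_path e (rcons s v ++ y :: t).
Proof.
move=> /andP[Us ss] /andP[Ut st] vy dis; rewrite /is_path cat_uniq Us Ut andbT.
apply/andP; split.
  by apply/negP=> /hasP[w wt]; apply/negP; apply: dis.
case: s ss {Us dis} => [|x s] /=; first by rewrite vy.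
by move=> ss; rewrite cat_path ss last_rcons /= vy.
Qed.

(** * Extremal systems of paths *)

Section Extremal.
(** [no_large_ext] and [no_drop] isolate what the minimality of p contributes:
    covering a large vertex in addition would lower the number of vertices in
    large components, and dropping v would lower the number of covered
    vertices while creating no component with more than m vertices, if the
    components adjacent to v had fewer than m vertices. *)
Variables (p : I -> seq T) (m : nat).
Let S := covered p.
Hypothesis p_sys : path_system p.
Hypothesis no_large_ext : forall p', path_system p' -> S \subset covered p' ->
  [disjoint covered p' & large e m S].
Hypothesis no_drop : forall p' v, path_system p' -> v \in S -> covered p' = S :\ v ->
  m <= #|comps_at e S v|.

Lemma large_off a : a \in large e m S -> a \notin S.
Proof. by rewrite inE in_setC => /andP[]. Qed.

Lemma path_nonempty i a : a \in large e m S -> p i != [::].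
Proof.
move=> aX; apply/eqP=> Ei; have aS := large_off aX.
pose p' := subst_path p i [:: a].
have sys' : path_system p'.
  apply: subst_path_system => // j ne_j.
  by rewrite disjoint_has /= orbF; apply: notin_covered.
have sub : S \subset covered p'.
  apply/subsetP=> v /coveredP[j vj]; apply: (@mem_covered _ j).
  by rewrite /p' /subst_path; case: eqP vj => // ->; rewrite Ei.
have aC : a \in covered p'.
  by apply: (@mem_covered _ i); rewrite /p' /subst_path eqxx inE.
by rewrite (disjointFr (no_large_ext sys' sub) aC) in aX.
Qed.

Lemma subst_off i s : is_path e s -> {subset p i <= s} ->
  {in s, forall v, v \in p i \/ v \notin S} ->
  path_system (subst_path p i s) /\ S \subset covered (subst_path p i s).
Proof.
move=> ps sub off_s; split.
  apply: subst_path_system => // j ne_j; rewrite disjoint_subset; apply/subsetP=> v vs.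
  rewrite inE; case: (off_s v vs) => [vi|]; last exact: notin_covered.
  by rewrite (disjointFl (p_sys.2 j i ne_j) vi).
apply/subsetP=> v /coveredP[j vj]; apply: (@mem_covered _ j).
by rewrite /subst_path; case: eqP vj => // ->; apply: sub.
Qed.

Lemma no_large_in_subst i s a : is_path e s -> {subset p i <= s} ->
  {in s, forall v, v \in p i \/ v \notin S} -> a \in s -> a \notin large e m S.
Proof.
move=> ps sub off_s a_s; have [sys' sub'] := subst_off ps sub off_s.
rewrite (disjointFr (no_large_ext sys' sub')) //; apply: (@mem_covered _ i).
by rewrite /subst_path eqxx.
Qed.

Lemma end_not_large i v a : is_end p i v -> e v a -> a \notin large e m S.
Proof.
move=> [s ps Es] va; apply/negP=> aX; have aS := large_off aX.
case/andP: ps => Us sort_s.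
suff : a \notin large e m S by rewrite aX.
apply: (@no_large_in_subst i (rcons (rcons s v) a)); last by rewrite mem_rcons mem_head.
- rewrite /is_path rcons_uniq Us andbT Es (notin_covered i aS) /=.
  by case: s sort_s {Us Es} => [|x s] /=; rewrite ?va // !rcons_path last_rcons va andbT.
- by move=> u; rewrite mem_rcons inE Es => ->; rewrite orbT.
by move=> u; rewrite mem_rcons inE Es => /orP[/eqP->|]; [right|left].
Qed.

Lemma end_in i v : is_end p i v -> v \in p i.
Proof. by case=> s _ <-; rewrite mem_rcons mem_head. Qed.

(** The bound holds because an endpoint can be dropped from its path, and the
    inclusion because an endpoint has no neighbour in a large component. *)
Lemma comps_at_end i v : is_end p i v ->
  m <= #|comps_at e S v| /\ comps_at e S v \subset ~: S :\: large e m S.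
Proof.
move=> ev; split; last first.
  apply/subsetP=> w; rewrite inE in_setC => /andP[wS /existsP[u /andP[vu uw]]].
  rewrite in_setD in_setC wS andbT.
  apply: contra (end_not_large ev vu) => wX; apply: large_comp wX _ => //.
  by rewrite inE off_csym.
have vi := end_in ev; case: ev => s /andP[]; rewrite rcons_uniq => /andP[vs Us] sort_s Es.
have sys' : path_system (subst_path p i s).
  apply: subst_path_system => //.
    rewrite /is_path Us; case: s sort_s {vs Us Es} => //= x s.
    by rewrite rcons_path => /andP[].
  move=> j ne_j; rewrite disjoint_sym; apply: disjointWr (p_sys.2 j i ne_j).
  by apply/subsetP=> u us; rewrite -Es mem_rcons inE us orbT.
apply: (no_drop sys'); first exact: mem_covered vi.
apply/setP=> u; rewrite in_setD1; apply/coveredP/andP.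
  case=> j; rewrite /subst_path; case: eqP => [_ us|/eqP ne_j uj].
    split; first by apply: contraNneq vs => <-.
    by apply: (@mem_covered _ i); rewrite -Es mem_rcons inE us orbT.
  split; last exact: mem_covered uj.
  by apply: contraTneq uj => ->; rewrite (disjointFl (p_sys.2 j i ne_j) vi).
case=> ne_u /coveredP[j uj]; exists j; rewrite /subst_path.
case: eqP uj => // ->; rewrite -Es mem_rcons inE => /orP[/eqP E|//].
by rewrite E eqxx in ne_u.
Qed.

Lemma link v v' w : w \in comps_at e S v -> w \in comps_at e S v' ->
  exists u q, [/\ uniq (u :: q), path e u q, e v u, e (last u q) v' &
    {subset u :: q <= comps_at e S v}].
Proof.
rewrite !inE => /andP[wS /existsP[u /andP[vu uw]]] /andP[_ /existsP[u' /andP[v'u' u'w]]].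
have uS : u \notin S by rewrite -(@comp_notin T e S u w) ?in_setC // inE.
have uu' : connect (off e S) u u' by apply: connect_trans uw _; rewrite off_csym.
have [q [Uq pq lq sq]] := path_in_comp uS uu'.
exists u, q; split=> //; first by rewrite lq e_sym.
move=> y /sq yu; apply: comps_at_comp yu.
by rewrite inE in_setC uS; apply/existsP; exists u; rewrite vu connect0.
Qed.


Lemma comps_at_off v w : w \in comps_at e S v -> w \notin S.
Proof. by rewrite inE in_setC => /andP[]. Qed.

(** A common component joins paths i and j into a single path, which takes the
    place of path i; path j then restarts at the large vertex a. *)
Lemma disjoint_comps_at_ends i j v v' a : a \in large e m S -> i != j ->
  is_end p i v -> is_end p j v' -> [disjoint comps_at e S v & comps_at e S v'].
Proof.
move=> aX ne_ij ev ev'; apply/pred0P=> w /=; apply/negP=> /andP[wv wv'].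
have [u [q [Uq pq vu qv' sq]]] := link wv wv'.
have [_ subL] := comps_at_end ev; have aS := large_off aX.
have vi := end_in ev; have v'j := end_in ev'.
case: ev ev' => s ps Es [s' ps' Es'].
have dij := p_sys.2 i j ne_ij.
pose t := (u :: q) ++ v' :: rev s'.
have Et x : (x \in rcons s v ++ t) = [|| x \in p i, x \in u :: q | x \in p j].
  by rewrite !mem_cat -rev_rcons mem_rev Es Es'.
have a_t : a \notin rcons s v ++ t.
  apply/negP; rewrite Et => /or3P[ai|/sq a_v|aj].
  - by rewrite (negPf (notin_covered i aS)) in ai.
  - by have := subsetP subL _ a_v; rewrite inE aX.
  - by rewrite (negPf (notin_covered j aS)) in aj.
have pt : is_path e (rcons s v ++ t).
  have tE : t = rcons (belast u q) (last u q) ++ v' :: rev s' by rewrite -lastI.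
  have pt : is_path e t.
    rewrite tE; apply: is_path_cat => //; first by rewrite -lastI /is_path Uq.
      by rewrite -rev_rcons is_path_rev.
    move=> x; rewrite -rev_rcons mem_rev Es' -lastI => xj; apply/negP=> /sq/comps_at_off.
    by rewrite (mem_covered xj).
  apply: is_path_cat => // x xt; rewrite Es; apply/negP=> xi.
  have := xt; rewrite -[u :: _]/t mem_cat -rev_rcons mem_rev Es' (disjointFr dij xi) orbF.
  by move=> /sq/comps_at_off; rewrite (mem_covered xi).
have sys1 : path_system (subst_path p j [:: a]).
  apply: subst_path_system => // l _; rewrite disjoint_has /= orbF; exact: notin_covered.
have sys2 : path_system (subst_path (subst_path p j [:: a]) i (rcons s v ++ t)).
  apply: subst_path_system => // l ne_l; rewrite /subst_path.
  case: eqP => [_|/eqP ne_lj]; first by rewrite disjoint_sym disjoint_has /= orbF.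
  rewrite disjoint_has; apply/hasPn=> x; rewrite Et /= => /or3P[xi|/sq/comps_at_off|xj].
  - by rewrite (disjointFl (p_sys.2 l i ne_l) xi).
  - exact: notin_covered.
  - by rewrite (disjointFl (p_sys.2 l j ne_lj) xj).
have sub : S \subset covered (subst_path (subst_path p j [:: a]) i (rcons s v ++ t)).
  apply/subsetP=> x /coveredP[l xl].
  have [El|ne_l] := eqVneq l i.
    by apply: (@mem_covered _ i); rewrite /subst_path eqxx Et -El xl.
  have [El'|ne_l'] := eqVneq l j.
    by apply: (@mem_covered _ i); rewrite /subst_path eqxx Et -El' xl !orbT.
  by apply: (@mem_covered _ l); rewrite /subst_path (negPf ne_l) (negPf ne_l').
have aC : a \in covered (subst_path (subst_path p j [:: a]) i (rcons s v ++ t)).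
  by apply: (@mem_covered _ j); rewrite /subst_path eq_sym (negPf ne_ij) eqxx inE.
by rewrite (disjointFr (no_large_ext sys2 sub) aC) in aX.
Qed.

(** Write the path as x ... z ... y.  With a connection q from x to y through a
    common component, the path a, z, back to x, through q, then from y back to
    the successor of z covers path i and the large vertex a. *)
Lemma disjoint_comps_at_same_path i x s z a : p i = x :: s -> z \in p i ->
  a \in large e m S -> e z a -> [disjoint comps_at e S x & comps_at e S (last x s)].
Proof.
move=> Ei zi aX za; have aS := large_off aX.
have ex := head_is_end p_sys Ei; have ey := last_is_end p_sys Ei.
have ne_x : z != x by apply: contraTneq aX => Ez; apply: (end_not_large ex); rewrite -Ez.
have ne_y : z != last x s.
  by apply: contraTneq aX => Ez; apply: (end_not_large ey); rewrite -Ez.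
have [y Ey] : exists y, y = last x s by exists (last x s).
rewrite -Ey in ey ne_y *.
apply/pred0P=> w /=; apply/negP=> /andP[wx wy].
have [u [q [Uq pq xu qy sq]]] := link wx wy.
have [_ subL] := comps_at_end ex.
have [h [r Es]] : exists h r, s = h ++ z :: rcons r y.
  move: zi; rewrite Ei inE (negPf ne_x) /= => zs.
  case/splitPr: zs Ey => h r; rewrite last_cat /=.
  case/lastP: r => [|r y'] /=; first by move=> E; rewrite E eqxx in ne_y.
  by rewrite last_rcons => ->; exists h, r.
have [] := andP (p_sys.1 i); rewrite Ei Es -cat_cons cat_uniq.
move=> /and3P[U1 /hasPn dis U2] sorted_i.
have [h_z z_r] : sorted e (rcons (x :: h) z) /\ sorted e (z :: rcons r y).
  move: sorted_i; rewrite /= cat_path /= => /and3P[sorted_h lz ->].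
  by rewrite rcons_path sorted_h lz.
have Ur : uniq (rcons r y) by case/andP: U2.
have Ep v : v \in p i = [|| v \in x :: h, v == z | v \in rcons r y].
  by rewrite Ei Es -cat_cons mem_cat [v \in z :: _]inE.
have a_i := notin_covered i aS.
suff : a \notin large e m S by rewrite aX.
pose t := (u :: q) ++ y :: rev r.
have Ehd : rcons (a :: z :: rev h) x = a :: rev (rcons (x :: h) z).
  by rewrite rev_rcons rev_cons.
have Et v : (v \in rcons (a :: z :: rev h) x ++ t) =
    [|| v == a, v \in u :: q | v \in p i].
  rewrite Ep Ehd cat_cons [v \in a :: _]in_cons !mem_cat mem_rev mem_rcons.
  rewrite [v \in z :: _]in_cons -rev_rcons mem_rev.
  case: (v == a) => //=; case: (v \in u :: q); rewrite ?orbT //=.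
  by rewrite [(v == z) || _]orbC orbA.
have tE : t = rcons (belast u q) (last u q) ++ y :: rev r by rewrite -lastI.
have off_q v : v \in u :: q -> v \notin p i.
  by move=> /sq/comps_at_off; apply: notin_covered.
apply: (@no_large_in_subst i (rcons (a :: z :: rev h) x ++ t)).
- have pt : is_path e t.
    rewrite tE; apply: is_path_cat => //; first by rewrite -lastI /is_path Uq.
      rewrite -rev_rcons is_path_rev /is_path Ur.
      exact: path_sorted z_r.
    move=> v; rewrite -rev_rcons mem_rev -lastI => v2; apply/negP=> /off_q.
    by rewrite Ep v2 !orbT.
  apply: is_path_cat => //; rewrite Ehd.
    have Uh : uniq (rcons (x :: h) z) by rewrite rcons_uniq dis ?mem_head.
    have a_h : a \notin rev (rcons (x :: h) z).
      rewrite mem_rev mem_rcons in_cons; apply: contra a_i.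
      by rewrite Ep => /orP[->|->]; rewrite ?orbT.
    rewrite /is_path cons_uniq rev_uniq Uh a_h /=.
    by move: h_z; rewrite -sorted_rev_sym rev_rcons /= e_sym za => ->.
  move=> v; rewrite -[u :: _]/t mem_cat -rev_rcons mem_rev.
  rewrite [v \in a :: _]in_cons negb_or mem_rev (mem_rcons (x :: h)).
  rewrite [v \in z :: _]in_cons => /orP[vq|vr]; apply/andP; split.
  - by apply: contraTneq (subsetP subL _ (sq v vq)) => ->; rewrite inE aX.
  - by apply: contra (off_q v vq); rewrite Ep => /orP[->|->]; rewrite ?orbT.
  - by apply: contraNneq a_i => <-; rewrite Ep vr !orbT.
  case/andP: U2 => z_r' _; rewrite negb_or (dis v) ?in_cons ?vr ?orbT // andbT.
  by apply: contraNneq z_r' => <-.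
- by move=> v vi; rewrite Et vi !orbT.
- move=> v; rewrite Et => /or3P[/eqP->|/sq/comps_at_off|]; by [right|left].
by rewrite Et eqxx.
Qed.

(** Outside the covered set, large components are closed under adjacency, so a
    red path that leaves them must do so through a covered vertex. *)
Lemma large_touches_path a : connected_graph e -> 0 < #|I| -> a \in large e m S ->
  exists i z b, [/\ z \in p i, b \in large e m S & e z b].
Proof.
move=> conn I_gt0 aX; have [i _] : exists i : I, i \in I by apply/card_gt0P.
have : p i != [::] by apply: path_nonempty aX.
case Ei: (p i) => [//|x s] _.
have xS : x \in S by apply: (@mem_covered _ i); rewrite Ei mem_head.
have [/existsP[b /existsP[z /and3P[bX bz zS]]]|none] :=
    boolP [exists b, exists z, [&& b \in large e m S, e b z & z \in S]].
  by have /coveredP[j zj] := zS; exists j, z, b; rewrite e_sym.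
have sub : [set y | connect e a y] \subset large e m S.
  apply: connect_closed aX => y z yX yz.
  have zS : z \notin S.
    apply: contra none => zS; apply/existsP; exists y; apply/existsP; exists z.
    by rewrite yX yz.
  apply: (large_comp e_sym yX); rewrite inE; apply: connect1.
  by rewrite offE yz zS large_off.
have := subsetP sub x; rewrite inE => /(_ (conn a x)) /large_off.
by rewrite xS.
Qed.

(** The disjoint sets N j provide the t * m vertices outside the large components
    that [spread_classes] requires. *)
Lemma spread_of_disjoint_comps (J : finType) (N : J -> {set T}) t a :
  comps_le e m.+1 S -> a \in large e m S -> #|J| = t ->
  (forall i j, i != j -> [disjoint N i & N j]) ->
  (forall j, m <= #|N j| /\ N j \subset ~: S :\: large e m S) ->
  exists q : seq T, [/\ uniq q, q =i ~: S & forall x0 i j,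
    i < j -> j < size q -> j <= i + t -> ~~ e (nth x0 q i) (nth x0 q j)].
Proof.
move=> le_S aX Jt disN leN.
pose X := large e m S; pose L := ~: S :\: X.
pose kappa x : nat := enum_rank (root (off e S) x).
have kappaE x y : (kappa y == kappa x) = (y \in comp e S x).
  rewrite inE -(root_connect (off_csym e_sym S)) eq_sym.
  by rewrite /kappa val_eqE (inj_eq enum_rank_inj).
have le_class (A : {set T}) x b : #|comp e S x| <= b ->
    #|[set y in A | kappa y == kappa x]| <= b.
  apply: leq_trans; apply/subset_leq_card/subsetP=> y; rewrite inE kappaE.
  by case/andP.
have disXL : [disjoint X & L].
  by apply/pred0P=> x /=; rewrite in_setD; case: (_ \in X).
have [||||| q [Uq qXL farq]] := @spread_classes T X L kappa m t disXL.
- by move=> x xX; apply/le_class/le_S/large_off.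
- move=> x; rewrite in_setD in_setC => /andP[xX xS]; apply: le_class.
  by move: xX; rewrite /X inE in_setC xS -leqNgt.
- move=> x y xX yL; apply/eqP=> E.
  have := large_comp e_sym xX (_ : y \in comp e S x); rewrite -kappaE E eqxx.
  by move=> /(_ isT) yX; rewrite -/X (disjointFl disXL yL) in yX.
- have : m < #|comp e S a| by move: aX; rewrite inE => /andP[].
  move/leq_trans; apply; apply/subset_leq_card/subsetP=> y.
  exact: (large_comp e_sym aX).
- rewrite -Jt; apply: leq_trans (_ : #|\bigcup_j N j| <= _); last first.
    by apply/subset_leq_card/bigcupsP=> j _; case: (leN j).
  rewrite -sum1_card partition_disjoint_bigcup // -sum_nat_const.
  by apply: leq_sum => j _; rewrite sum1_card; case: (leN j).
have qS : q =i ~: S.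
  move=> x; rewrite qXL in_setU in_setD; case: (boolP (x \in X)) => //=.
  by move/large_off; rewrite in_setC => ->.
exists q; split=> // x0 i j lt_ij lt_j le_j; apply: contra (farq x0 i j lt_ij lt_j le_j).
move=> eij; rewrite eq_sym kappaE inE; apply: connect1; rewrite offE eij.
have off_q l : l < size q -> nth x0 q l \notin S by move=> lt; rewrite -in_setC -qS mem_nth.
by rewrite !off_q // (ltn_trans lt_ij).
Qed.

End Extremal.

Lemma minimal_witness (A : Type) (P : A -> Prop) (f : A -> nat) :
  (exists a, P a) -> exists a, P a /\ forall b, P b -> f a <= f b.
Proof.
case=> a; have [n] := ubnP (f a); elim: n a => // n IHn a le_n Pa.
have [[b [Pb lt_b]]|none] := classic (exists b, P b /\ f b < f a).
  by apply: IHn Pb; apply: leq_trans lt_b _.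
exists a; split=> // b Pb; rewrite leqNgt; apply/negP=> lt_b.
by apply: none; exists b.
Qed.

(** Induction on the bound m for the component sizes.  Among the systems with
    bound m + 1 take one minimising lexicographically the number of vertices in
    components of size m + 1 and the number of covered vertices; the factor
    #|T| + 1 encodes the lexicographic order.  If no component has size m + 1,
    the bound can be lowered. *)
Lemma extremal_system m p0 : path_system p0 -> comps_le e m (covered p0) ->
  (exists p, path_system p /\ covered p = setT) \/
  exists p l a, [/\ path_system p, comps_le e l.+1 (covered p), a \in large e l (covered p),
    (forall p', path_system p' -> covered p \subset covered p' ->
       [disjoint covered p' & large e l (covered p)]) &
    (forall p' v, path_system p' -> v \in covered p -> covered p' = covered p :\ v ->
       l <= #|comps_at e (covered p) v|)].
Proof.
elim: m p0 => [|m IHm] p0 sys0 le0.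
  left; exists p0; split=> //; apply/setP=> x; rewrite in_setT.
  apply/negPn/negP=> /le0; rewrite leqn0 cards_eq0 => /eqP E.
  by have := in_set0 x; rewrite -E inE connect0.
pose f p := #|large e m (covered p)| * #|T|.+1 + #|covered p|.
have [p [[sys_p le_p] min_p]] := @minimal_witness _
  (fun p => path_system p /\ comps_le e m.+1 (covered p)) f (ex_intro _ p0 (conj sys0 le0)).
have [X0|[a aX]] := set_0Vmem (large e m (covered p)).
  apply: (IHm p) => // x xS; rewrite leqNgt; apply/negP=> lt_x.
  by have := in_set0 x; rewrite -X0 inE in_setC xS lt_x.
right; exists p, m, a; split=> //.
  move=> p' sys' sub; have := min_p p' (conj sys' (comps_le_mono sub le_p)).
  apply: contraTT => /pred0Pn[b /andP[/= bp' bX]]; rewrite -ltnNge /f.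
  have : large e m (covered p') \proper large e m (covered p).
    apply/properP; split; first exact: large_mono.
    by exists b => //; rewrite inE in_setC bp'.
  have le_T : #|covered p'| <= #|T| := max_card _.
  by move/proper_card => lt; have := leq_mul lt (leqnn #|T|.+1); lia.
move=> p' v sys' vS E; rewrite leqNgt; apply/negP=> lt_m.
have := min_p p' _; rewrite /f E.
have := subset_leq_card (large_drop e_sym vS lt_m).
have := cardsD1 v (covered p); rewrite vS => -> le_X H.
have {}H := H (conj sys' _); have := H (drop_small e_sym vS (leqW lt_m) le_p).
by have := leq_mul le_X (leqnn #|T|.+1); lia.
Qed.

(** * Covering the vertices *)

Definition covered_upto t := exists p (q : seq T), [/\ path_system p, uniq q,
  q =i ~: covered p & forall x0 i j,
    i < j -> j < size q -> j <= i + t -> ~~ e (nth x0 q i) (nth x0 q j)].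

Lemma empty_system : path_system (fun=> [::]).
Proof. by split=> // i j _; rewrite disjoint_has. Qed.

(** The family of disjoint sets is indexed by the paths, with their last
    vertices; in the connected case None stands for the first vertex of a path
    that has a vertex adjacent to a large component. *)
Lemma covered_upto_card : covered_upto #|I| /\
  (connected_graph e -> 0 < #|I| -> covered_upto #|I|.+1).
Proof.
have le0 : comps_le e #|T| (covered (fun=> [::])) by move=> x _; apply: max_card.
have [[p [sys_p full]]|[p [m [a [sys_p le_p aX ext drop]]]]] :=
    extremal_system empty_system le0.
  have all t : covered_upto t.
    by exists p, [::]; split=> // x; rewrite full setCT in_set0.
  by split=> [|? ?]; apply: all.
pose hd i := head a (p i); pose lst i := last a (p i).
have ends i : is_end p i (hd i) /\ is_end p i (lst i).
  have := path_nonempty sys_p ext i aX; rewrite /hd /lst.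
  case Ei: (p i) => [//|x s] _; split; first exact: head_is_end Ei.
  exact: last_is_end Ei.
have big_end i v := comps_at_end sys_p ext drop (i := i) (v := v).
have dis_ends i j v v' :=
  disjoint_comps_at_ends sys_p ext drop aX (i := i) (j := j) (v := v) (v' := v').
pose N v := comps_at e (covered p) v.
split.
  have [i j ne|i|q [Uq qS farq]] :=
      spread_of_disjoint_comps (N := fun i => N (lst i)) le_p aX (erefl #|I|).
  - exact: dis_ends ne (ends i).2 (ends j).2.
  - exact: big_end (ends i).2.
  by exists p, q; split.
move=> conn I_gt0.
have [i0 [z [b [zi bX zb]]]] := large_touches_path sys_p ext conn I_gt0 aX.
pose pick (o : option I) := if o is Some i then N (lst i) else N (hd i0).
have dis0 : [disjoint N (hd i0) & N (lst i0)].
  rewrite /N /hd /lst; case Ei: (p i0) zi => [//|x s] zi.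
  by apply: (disjoint_comps_at_same_path sys_p ext drop Ei _ bX zb); rewrite Ei.
have dis_hd j : [disjoint N (hd i0) & N (lst j)].
  have [<-//|ne] := eqVneq i0 j; exact: dis_ends ne (ends i0).1 (ends j).2.
have [o o' ne|o|q [Uq qS farq]] :=
    spread_of_disjoint_comps (N := pick) le_p aX (card_option I).
- case: o o' ne => [i|] [j|] //= ne; last by rewrite disjoint_sym.
  exact: dis_ends ne (ends i).2 (ends j).2.
- by case: o => [i|]; [apply: big_end (ends i).2|apply: big_end (ends i0).1].
by exists p, q; split.
Qed.

End PathSystems.

Theorem corollary1p10 (k : nat) (hk : 1 <= k) (n : nat)
    (c : 'I_n -> 'I_n -> colour) (csym : forall x y, c x y = c y x) :
  covered_by c k k /\
  (connected_graph (red c) -> covered_by c k k.+1).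
Proof.
have red_sym : symmetric (red c) by move=> x y; rewrite /red csym eq_sym.
have blue_sym : symmetric (blue c) by move=> x y; rewrite /blue csym eq_sym.
have cover t : covered_upto (red c) 'I_k t -> covered_by c k t.
  case=> p [q [[pp dp] Uq qS far]]; exists p, q; split=> //.
  - split=> // i j; wlog lt_ij : i j / i < j => [wlog_lt|].
      move=> pw; have [lt|lt|E] := ltngtP i j; first exact: wlog_lt.
        by rewrite blue_sym; apply: wlog_lt => //; move: pw; rewrite /path_power; lia.
      by move: pw; rewrite /path_power; lia.
    rewrite /path_power => pw; have x0 := tnth (in_tuple q) i.
    rewrite !(tnth_nth x0) /=; have := far x0 i j lt_ij (ltn_ord j).
    rewrite /red /blue nth_uniq //; have -> : (nat_of_ord i != j) by lia.
    by apply; lia.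
  - move=> i; rewrite disjoint_sym disjoint_has; apply/hasPn=> v; rewrite qS in_setC.
    exact: notin_covered.
  move=> v; have [/coveredP|] := boolP (v \in covered p); first by right.
  by rewrite -in_setC -qS; left.
have [] := covered_upto_card red_sym 'I_k; rewrite card_ord => low high.
by split=> [|conn]; apply: cover => //; apply: high.
Qed.
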